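(* Let $p$ be a prime, $n$ a natural number, and $\lambda_1\geq\cdots\geq\lambda_t$ a partition of $n$. Let $U=\mathbb{Z}/p^{\lambda_1}\mathbb{Z}\oplus\cdots\oplus\mathbb{Z}/p^{\lambda_t}\mathbb{Z}$ and let $V$ be the $\mathbb{F}_p[T]/(T^n)$-module $\mathbb{F}_p[T]/(T^{\lambda_1})\oplus\cdots\oplus\mathbb{F}_p[T]/(T^{\lambda_t})$. Then: (1) There is a one-to-one correspondence between isomorphism classes of rings $R$ whose additive group is $U$ and which satisfy $p[R,R]=0$, and isomorphism classes of $\mathbb{F}_p[T]/(T^n)$-algebras $A$ whose underlying module is $V$ and which satisfy $T[A,A]=0$. (2) This correspondence maps isomorphism classes of Lie rings exactly onto isomorphism classes of $\mathbb{F}_p[T]/(T^n)$-Lie algebras; and for corresponding Lie ring $R$ and Lie algebra $A$, $R$ is nilpotent if and only if $A$ is nilpotent.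
   Context: For a commutative ring $C$ with $1$, a $C$-algebra is a unital $C$-module $A$ together with a $C$-bilinear multiplication $[\cdot,\cdot]:A\times A\to A$ (i.e. an element of $\mathrm{Hom}_C(A\otimes_C A,A)$); no associativity or identity element is assumed. A ring means a $\mathbb{Z}$-algebra in this sense. $[R,R]$ denotes the additive subgroup (submodule) generated by all products, so $p[R,R]=0$ means $p\cdot[x,y]=0$ for all $x,y$, and $T[A,A]=0$ means $T\cdot[a,b]=0$ for all $a,b$. A Lie ring (resp. Lie algebra) is such an algebra with $[x,x]=0$ for all $x$ and satisfying the Jacobi identity $[[x,y],z]+[[y,z],x]+[[z,x],y]=0$. Isomorphisms are bijections that are module isomorphisms preserving multiplication. *)

(* Defs.v *)
From HB Require Import structures.
From mathcomp Require Import all_boot all_order all_algebra.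
Set Implicit Arguments. Unset Strict Implicit. Unset Printing Implicit Defensive.
Import GRing.Theory.
Local Open Scope ring_scope.

Section DSum.
Variables (I : finType) (G : I -> zmodType).
Definition dsum := {dffun forall i : I, G i}.
Definition dsum0 : dsum := finfun (fun i => (0 : G i)).
Definition dsum_add (x y : dsum) : dsum := finfun (fun i => x i + y i).
Definition dsum_opp (x : dsum) : dsum := finfun (fun i => - x i).
Fact dsum_addA : associative dsum_add.
Proof. by move=> x y z; apply/ffunP=> i; rewrite !ffunE addrA. Qed.
Fact dsum_addC : commutative dsum_add.
Proof. by move=> x y; apply/ffunP=> i; rewrite !ffunE addrC. Qed.
Fact dsum_add0 : left_id dsum0 dsum_add.
Proof. by move=> x; apply/ffunP=> i; rewrite !ffunE add0r. Qed.
Fact dsum_addN : left_inverse dsum0 dsum_opp dsum_add.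
Proof. by move=> x; apply/ffunP=> i; rewrite !ffunE addNr. Qed.
HB.instance Definition _ := Choice.on dsum.
HB.instance Definition _ :=
  GRing.isZmodule.Build dsum dsum_addA dsum_addC dsum_add0 dsum_addN.
End DSum.

Definition is_partition (n : nat) (lam : seq nat) : Prop :=
  [/\ sorted geq lam, all (fun k => 0 < k)%N lam & sumn lam = n].

(* U = Z/p^{lam_1} (+) ... (+) Z/p^{lam_t}   (each p^{lam_i} >= 2) *)
Definition Ugrp (p : nat) (lam : seq nat) : zmodType :=
  dsum (fun i : 'I_(size lam) => ('Z_(p ^ nth 0 lam i) : zmodType)).

Definition Cring (p n : nat) : comNzRingType := ({poly %/ ('X^n : {poly 'F_p})} : comNzRingType).
Definition Tgen (p n : nat) : Cring p n := in_qpoly ('X^n : {poly 'F_p}) 'X.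

Definition Vgrp (p : nat) (lam : seq nat) : zmodType :=
  dsum (fun i : 'I_(size lam) => ({poly %/ ('X^(nth 0 lam i) : {poly 'F_p})} : zmodType)).

Definition actV (p n : nat) (lam : seq nat) (c : Cring p n) (v : Vgrp p lam) : Vgrp p lam :=
  finfun (fun i : 'I_(size lam) =>
    in_qpoly ('X^(nth 0 lam i) : {poly 'F_p}) ((c : {poly 'F_p}) * (v i : {poly 'F_p}))).

(* A ring structure on the abelian group M is a biadditive product. *)
Definition biadditive (M : zmodType) (m : M -> M -> M) : Prop :=
  (forall x y z, m (x + y) z = m x z + m y z) /\
  (forall x y z, m x (y + z) = m x y + m x z).

Definition ring_iso (M : zmodType) (m1 m2 : M -> M -> M) : Prop :=
  exists f : M -> M, [/\ bijective f, (forall x y, f (x + y) = f x + f y)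
                       & (forall x y, f (m1 x y) = m2 (f x) (f y))].

Definition is_Calgebra (C : nzRingType) (M : zmodType) (act : C -> M -> M)
    (a : M -> M -> M) : Prop :=
  biadditive a /\
  (forall c x y, a (act c x) y = act c (a x y)) /\
  (forall c x y, a x (act c y) = act c (a x y)).

Definition Calg_iso (C : nzRingType) (M : zmodType) (act : C -> M -> M)
    (a1 a2 : M -> M -> M) : Prop :=
  exists f : M -> M, [/\ bijective f, (forall x y, f (x + y) = f x + f y),
                       (forall c x, f (act c x) = act c (f x))
                       & (forall x y, f (a1 x y) = a2 (f x) (f y))].

Definition is_Lie (M : zmodType) (m : M -> M -> M) : Prop :=
  (forall x, m x x = 0) /\
  (forall x y z, m (m x y) z + m (m y z) x + m (m z x) y = 0).

Inductive zspan (M : zmodType) (S : M -> Prop) : M -> Prop :=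
| zspan_gen x : S x -> zspan S x
| zspan_0 : zspan S 0
| zspan_sub x y : zspan S x -> zspan S y -> zspan S (x - y).

Inductive cspan (C : nzRingType) (M : zmodType) (act : C -> M -> M) (S : M -> Prop)
    : M -> Prop :=
| cspan_gen x : S x -> cspan act S x
| cspan_0 : cspan act S 0
| cspan_sub x y : cspan act S x -> cspan act S y -> cspan act S (x - y)
| cspan_act c x : cspan act S x -> cspan act S (act c x).

(* lcs m k = gamma_{k+1}(R): gamma_1 = R, gamma_{k+1} = [gamma_k, R] *)
Fixpoint lcs (M : zmodType) (m : M -> M -> M) (k : nat) : M -> Prop :=
  match k with
  | 0 => fun _ => True
  | k'.+1 => zspan (fun z => exists x y, lcs m k' x /\ z = m x y)
  end.

Fixpoint lcsC (C : nzRingType) (M : zmodType) (act : C -> M -> M)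
    (a : M -> M -> M) (k : nat) : M -> Prop :=
  match k with
  | 0 => fun _ => True
  | k'.+1 => cspan act (fun z => exists x y, lcsC act a k' x /\ z = a x y)
  end.

Definition nilpotent_ring (M : zmodType) (m : M -> M -> M) : Prop :=
  exists k, forall x, lcs m k x -> x = 0.

Definition nilpotent_Calg (C : nzRingType) (M : zmodType) (act : C -> M -> M)
    (a : M -> M -> M) : Prop :=
  exists k, forall x, lcsC act a k x -> x = 0.

Definition goodU (p : nat) (lam : seq nat) (m : Ugrp p lam -> Ugrp p lam -> Ugrp p lam) :=
  biadditive m /\ (forall x y, (m x y) *+ p = 0).

Definition goodV (p n : nat) (lam : seq nat) (a : Vgrp p lam -> Vgrp p lam -> Vgrp p lam) :=
  is_Calgebra (@actV p n lam) a /\ (forall x y, actV (Tgen p n) (a x y) = 0).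

(* Main.v *)
(** Let [tau] be multiplication by [p] on [U], respectively by [T] on [V]. In both
    cases the quotient by the image of [tau] and the kernel of [tau] are identified
    with the same space [K = F_p^t], through [pi : M -> K] and [iota : K -> M]. A
    product annihilated by [tau] is the same thing as a biadditive map
    [b : K -> K -> K], via [m x y = iota (b (pi x) (pi y))]; this gives the
    correspondence. An automorphism commuting with [tau] induces a pair
    [(al, be)] of maps of [K], on the quotient and on the kernel, and the pairs that
    arise are those preserving, for every [k], the set of
    [(pi x, iota^-1 (tau^k x))] with [tau^(k+1) x = 0]. That set, and hence the
    isomorphism relation on the forms [b], depends only on the partition; so does
    [pi \o iota], which governs the Lie and nilpotency conditions. *)

Require Import Defs.
From HB Require Import structures.
From mathcomp Require Import all_boot all_order all_algebra.
Set Implicit Arguments. Unset Strict Implicit. Unset Printing Implicit Defensive.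
Import GRing.Theory.
Local Open Scope ring_scope.

(** * Additive maps, natural multiples and spans *)

Section AdditiveFunctions.
Variables (M N : zmodType) (f : M -> N).
Hypothesis fD : {morph f : x y / x + y}.

Lemma morphD0 : f 0 = 0.
Proof. by apply: (addrI (f 0)); rewrite -fD !addr0. Qed.

Lemma morphDN x : f (- x) = - f x.
Proof. by apply: (addrI (f x)); rewrite -fD !subrr morphD0. Qed.

Lemma morphDB x y : f (x - y) = f x - f y.
Proof. by rewrite fD morphDN. Qed.

Lemma morphDMn x k : f (x *+ k) = f x *+ k.
Proof. by elim: k => [|k IHk]; rewrite ?mulr0n ?morphD0 // !mulrS fD IHk. Qed.

Lemma morphD_sum (I : finType) (F : I -> M) : f (\sum_i F i) = \sum_i f (F i).
Proof. by apply: (big_morph f fD morphD0). Qed.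

Lemma morphD_inj : (forall x, f x = 0 -> x = 0) -> injective f.
Proof.
move=> f0 x y fxy; apply/eqP; rewrite -subr_eq0; apply/eqP/f0.
by rewrite morphDB fxy subrr.
Qed.

End AdditiveFunctions.

Lemma iter_morphD (M : zmodType) (f : M -> M) k :
  {morph f : x y / x + y} -> {morph iter k f : x y / x + y}.
Proof. by move=> fD; elim: k => [|k IHk] x y //; rewrite !iterS IHk fD. Qed.

Lemma iter_comm (M N : Type) (f : M -> N) (s : M -> M) (t : N -> N) k :
  (forall x, f (s x) = t (f x)) -> forall x, f (iter k s x) = iter k t (f x).
Proof. by move=> fst x; elim: k => //= k IHk; rewrite fst IHk. Qed.

Lemma mulrn_mod (M : zmodType) (z : M) q k : z *+ q = 0 -> z *+ (k %% q) = z *+ k.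
Proof.
by move=> zq; rewrite {2}(divn_eq k q) mulrnDr mulnC mulrnA zq mul0rn add0r.
Qed.

(** Addition in ['F_p] reduces representatives modulo [p]; on an element killed by [p] this
    reduction is invisible. *)
Lemma FpMnD p (M : zmodType) (z : M) (c d : 'F_p) :
  prime p -> z *+ p = 0 -> z *+ (c + d)%R = z *+ c + z *+ d.
Proof.
by move=> p_pr zp; rewrite -mulrnDr [LHS]mulrn_mod // Fp_cast.
Qed.

(** Each scalar of a prime field is a natural multiple of 1, so additive maps on row vectors are
    determined by the standard basis. *)
Lemma morphD_row_eq p t (N : zmodType) (f g : 'rV['F_p]_t -> N) : prime p ->
  {morph f : x y / x + y} -> {morph g : x y / x + y} ->
  (forall j, f (delta_mx 0 j) = g (delta_mx 0 j)) -> f =1 g.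
Proof.
move=> p_pr fD gD fg u; rewrite (row_sum_delta u) !morphD_sum //.
apply: eq_bigr => j _.
have -> : u 0 j *: delta_mx 0 j = (delta_mx 0 j : 'rV['F_p]_t) *+ (u 0 j : 'F_p).
  by rewrite -[X in X *: _]natr_Zp scaler_nat.
by rewrite !morphDMn // fg.
Qed.

Lemma lcs_shrink (M : zmodType) (m : M -> M -> M) k x : lcs m k.+1 x -> lcs m k x.
Proof.
elim: k x => [//|k IHk] x /=.
elim=> [{}x [y [z [Ly ->]]]||{}x y _ IHx _ IHy].
- by apply: zspan_gen; exists y, z; split=> //; apply: IHk.
- exact: zspan_0.
- exact: zspan_sub.
Qed.

(** * Frames: modules with a nilpotent operator, and forms on [K] *)

Section Frames.
Variables (p t : nat) (lam : 'I_t -> nat).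
Hypotheses (p_pr : prime p) (lam_gt0 : forall i, (0 < lam i)%N).
Local Notation K := 'rV['F_p]_t.

(* The pairs [(pi x, iota^-1 (tau^k x))] with [tau^(k+1) x = 0], described
   without reference to the module; see [frame_tor] below. *)
Definition torsion_pair (k : nat) (u v : K) : Prop :=
  forall i, [/\ (k.+1 < lam i)%N -> u 0 i = 0,
                lam i = k.+1 -> u 0 i = v 0 i
              & (lam i < k.+1)%N -> v 0 i = 0].

(* [pi] identifies [M / tau M], and [iota] identifies the kernel of [tau],
   with the same space [K]. *)
Record frame (M : zmodType) (tau : M -> M) (pi : M -> K) (iota : K -> M) : Prop :=
  Frame {
    frame_tauD : {morph tau : x y / x + y};
    frame_piD : {morph pi : x y / x + y};
    frame_iotaD : {morph iota : x y / x + y};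
    frame_pi_surj : forall u, exists x, pi x = u;
    frame_pi_tau : forall x, pi (tau x) = 0;
    frame_pi_ker : forall x, pi x = 0 -> exists y, x = tau y;
    frame_iota_ker : forall v, iota v = 0 -> v = 0;
    frame_tau_iota : forall v, tau (iota v) = 0;
    frame_tau_ker : forall x, tau x = 0 -> exists v, x = iota v;
    frame_tau_nil : exists N, forall x, iter N tau x = 0;
    frame_inj_bij : forall f : M -> M, injective f -> bijective f;
    frame_tor : forall k u v, torsion_pair k u v <->
      exists x, [/\ iter k.+1 tau x = 0, pi x = u & iter k tau x = iota v];
    frame_basis : exists e : 'I_t -> M,
      [/\ forall j, pi (e j) = delta_mx 0 j,
          forall j, iter (lam j).-1 tau (e j) = iota (delta_mx 0 j)
        & forall y : 'I_t -> M, (forall j, iter (lam j) tau (y j) = 0) ->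
          exists f : M -> M, [/\ {morph f : x y / x + y},
            forall x, f (tau x) = tau (f x) & forall j, f (e j) = y j]] }.

Definition represents (M : zmodType) (pi : M -> K) (iota : K -> M)
    (m : M -> M -> M) (b : K -> K -> K) : Prop :=
  forall x y, m x y = iota (b (pi x) (pi y)).

(** The last two clauses make [m] factor through [pi] in each argument. On [U] they come from
    biadditivity, on [V] from linearity over [T]. *)
Definition tau_good (M : zmodType) (tau : M -> M) (m : M -> M -> M) : Prop :=
  [/\ biadditive m, forall x y, tau (m x y) = 0,
      forall x y, m (tau x) y = 0 & forall x y, m x (tau y) = 0].

Definition tau_iso (M : zmodType) (tau : M -> M) (m1 m2 : M -> M -> M) : Prop :=
  exists f : M -> M, [/\ bijective f, {morph f : x y / x + y},
    forall x, f (tau x) = tau (f x) & forall x y, f (m1 x y) = m2 (f x) (f y)].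

(** Injectivity is required of [be] alone: by [endo_inj] it makes the lift to [M] injective, and
    [frame_inj_bij] then makes the lift bijective. *)
Definition form_iso (b1 b2 : K -> K -> K) : Prop :=
  exists al be : K -> K,
    [/\ {morph al : x y / x + y}, {morph be : x y / x + y},
        forall v, be v = 0 -> v = 0,
        forall k u v, torsion_pair k u v -> torsion_pair k (al u) (be v)
      & forall u v, be (b1 u v) = b2 (al u) (al v)].

(** * Products on one framed module and their forms *)

Section OneFrame.
Variables (M : zmodType) (tau : M -> M) (pi : M -> K) (iota : K -> M).
Hypothesis fr : frame tau pi iota.

Let tauD := frame_tauD fr.
Let piD := frame_piD fr.
Let iotaD := frame_iotaD fr.
Let pi_tau := frame_pi_tau fr.
Let tau_iota := frame_tau_iota fr.
Let iota_inj : injective iota := morphD_inj iotaD (frame_iota_ker fr).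

(** The section is chosen pointwise over the finite [K] and need not be additive; two lifts of the
    same vector differ by an element of [tau M]. *)
Lemma pi_section : exists s, cancel s pi.
Proof.
have [s sK] := fin_all_exists (frame_pi_surj fr).
by exists s.
Qed.

Lemma iota_retraction : exists r, cancel iota r.
Proof.
exists (fun x => odflt 0 [pick v | iota v == x]) => v.
by case: pickP => [w /eqP/iota_inj-> //|/(_ v)]; rewrite eqxx.
Qed.

Lemma pi_eq x y : pi x = pi y -> exists z, x = y + tau z.
Proof.
move=> pxy; have [|z xyz] := frame_pi_ker fr (x := x - y).
  by rewrite morphDB // pxy subrr.
by exists z; rewrite -xyz addrC subrK.
Qed.

Section Form.
Variables (s : K -> M) (r : M -> K).
Hypotheses (sK : cancel s pi) (rK : cancel iota r).

(** Values of [m] lie in the kernel of [tau], hence in the image of [iota], and changing an argument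
    modulo [tau M] does not affect them. *)
Lemma tau_good_represents m : tau_good tau m ->
  represents pi iota m (fun u v => r (m (s u) (s v))).
Proof.
move=> [[mDl mDr] tm mtl mtr] x y.
have [w mw] := frame_tau_ker fr (tm (s (pi x)) (s (pi y))).
rewrite mw rK -mw.
have [z ->] := pi_eq (esym (sK (pi x))).
have [z' ->] := pi_eq (esym (sK (pi y))).
rewrite mDl mtl addr0 mDr mtr addr0 !piD !pi_tau // !addr0.
by rewrite !sK.
Qed.

Lemma represents_biadditive m b : tau_good tau m -> represents pi iota m b ->
  biadditive b.
Proof.
move=> [[mDl mDr] _ _ _] mb; split=> u v w; apply: iota_inj; rewrite iotaD.
  by rewrite -(sK u) -(sK v) -(sK w) -piD -!mb mDl.
by rewrite -(sK u) -(sK v) -(sK w) -piD -!mb mDr.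
Qed.

Lemma represents_tau_good m b : biadditive b -> represents pi iota m b ->
  tau_good tau m.
Proof.
move=> [bDl bDr] mb.
have b0l v : b 0 v = 0 by exact: (morphD0 (fun u w => bDl u w v)).
have b0r v : b v 0 = 0 by exact: (morphD0 (bDr v)).
split; first by split=> x y z; rewrite !mb -iotaD piD ?bDl ?bDr.
- by move=> x y; rewrite mb tau_iota.
- by move=> x y; rewrite mb pi_tau // b0l morphD0.
- by move=> x y; rewrite mb pi_tau // b0r morphD0.
Qed.

(** An automorphism commuting with [tau] preserves both [tau M] and the kernel of [tau], so it
    induces [al] on the quotient and [be] on the kernel. *)
Lemma tau_iso_form m1 m2 b1 b2 :
  represents pi iota m1 b1 -> represents pi iota m2 b2 ->
  tau_iso tau m1 m2 -> form_iso b1 b2.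
Proof.
move=> mb1 mb2 [f [/bij_inj f_inj fD ft fm]].
have f0 := morphD0 fD.
pose al u := pi (f (s u)); pose be v := r (f (iota v)).
have alE x : pi (f x) = al (pi x).
  have [z xz] := pi_eq (esym (sK (pi x))).
  by rewrite {1}xz fD ft piD pi_tau // addr0.
have beE v : f (iota v) = iota (be v).
  have [|w fw] := frame_tau_ker fr (x := f (iota v)).
    by rewrite -ft tau_iota.
  by rewrite /be fw rK.
exists al, be; split.
- by move=> u v; rewrite -(sK u) -(sK v) -piD -!alE fD piD.
- by move=> u v; apply: iota_inj; rewrite iotaD -!beE iotaD fD.
- move=> v bev; apply: (frame_iota_ker fr); apply: f_inj.
  by rewrite beE bev f0 morphD0.
- move=> k u v /(frame_tor fr)[x [x0 xu xv]]; apply/(frame_tor fr).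
  exists (f x); split; last by rewrite -(iter_comm _ ft) xv beE.
    by rewrite -(iter_comm _ ft) x0.
  by rewrite alE xu.
- move=> u v; apply: iota_inj.
  by rewrite -beE -(sK u) -(sK v) -mb1 fm mb2 !alE.
Qed.

(* A nonzero kernel of an endomorphism meets the kernel of the nilpotent [tau],
   so injectivity is detected on the image of [iota]. *)
Lemma endo_inj (f : M -> M) : {morph f : x y / x + y} ->
  (forall x, f (tau x) = tau (f x)) -> (forall v, f (iota v) = 0 -> v = 0) ->
  injective f.
Proof.
move=> fD ft fi; apply: morphD_inj => // x fx.
have [N tN] := frame_tau_nil fr; have := tN x; elim: N {tN} => [//|N IHN] /=.
move=> /(frame_tau_ker fr)[v xv]; apply: IHN.
rewrite xv (fi v) ?morphD0 //.
by rewrite -xv (iter_comm _ ft) fx (morphD0 (iter_morphD _ tauD)).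
Qed.

Lemma torsion_pair_delta j :
  torsion_pair (lam j).-1 (delta_mx 0 j) (delta_mx 0 j).
Proof.
move=> i; rewrite !mxE prednK // eqxx /=.
by case: (eqVneq i j) => [->|_]; split; rewrite ?ltnn.
Qed.

Lemma form_tau_iso m1 m2 b1 b2 :
  represents pi iota m1 b1 -> represents pi iota m2 b2 ->
  form_iso b1 b2 -> tau_iso tau m1 m2.
Proof.
move=> mb1 mb2 [al [be [alD beD be_ker tor alb]]].
have [e [pe te lift]] := frame_basis fr.
(* The generator [e j] realises the torsion pair of [delta_mx 0 j] with itself at level
   [(lam j).-1]. Its image under [(al, be)] is again a torsion pair, and an element realising that
   one is an admissible image for [e j]. *)
have /fin_all_exists[y yP] : forall j, exists y,
    [/\ iter (lam j) tau y = 0, pi y = al (delta_mx 0 j)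
      & iter (lam j).-1 tau y = iota (be (delta_mx 0 j))].
  move=> j; have /(frame_tor fr)[y yP] := tor _ _ _ (torsion_pair_delta j).
  by exists y; rewrite -{1}(prednK (lam_gt0 j)).
have [|f [fD ft fe]] := lift y; first by move=> j; case: (yP j).
have alE x : pi (f x) = al (pi x).
  have [z ->] := pi_eq (esym (sK (pi x))).
  rewrite fD ft !piD !pi_tau // !addr0 sK.
  (* The map [pi \o f \o s] is additive although [s] need not be: the defect of [s] lies in [tau M],
     which [f] preserves and [pi] kills. *)
  move: (pi x); apply: morphD_row_eq => //.
    move=> u v; have [|w ->] := @pi_eq (s (u + v)) (s u + s v).
      by rewrite piD !sK.
    by rewrite !fD ft !piD pi_tau // addr0.
  move=> j; have [|w ->] := @pi_eq (s (delta_mx 0 j)) (e j); first by rewrite sK pe.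
  by rewrite fD ft piD pi_tau // addr0 fe; case: (yP j).
have beE v : f (iota v) = iota (be v).
  move: v; apply: morphD_row_eq => //; first by move=> u v; rewrite iotaD fD.
    by move=> u v; rewrite beD iotaD.
  by move=> j; rewrite -te (iter_comm _ ft) fe; case: (yP j).
exists f; split=> //; last by move=> x y'; rewrite mb1 mb2 beE alb !alE.
apply/(frame_inj_bij fr)/endo_inj => // v; rewrite beE => /(frame_iota_ker fr).
exact: be_ker.
Qed.

(** In a nested product the inner value enters the outer form through [pi \o iota], so the Jacobi
    identity can be tested on [K]. *)
Lemma is_Lie_represents m b : represents pi iota m b ->
  is_Lie m <-> (forall u, b u u = 0) /\
    forall u v w, b (pi (iota (b u v))) w + b (pi (iota (b v w))) u
                + b (pi (iota (b w u))) v = 0.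
Proof.
move=> mb; split=> -[alt jac]; split=> [u|u v w].
- by apply: iota_inj; rewrite -[X in b X X]sK -mb alt morphD0.
- apply: iota_inj; rewrite morphD0 // !iotaD.
  by rewrite -[u]sK -[v]sK -[w]sK -!mb jac.
- by rewrite mb alt morphD0.
- by rewrite !mb -!iotaD jac morphD0.
Qed.

End Form.

(** At level 0 the torsion pairs are the graph of [pi \o iota], which therefore depends on [lam]
    only. *)
Lemma pi_iota_torsion u v : pi (iota v) = u <-> torsion_pair 0 u v.
Proof.
split=> [<-|/(frame_tor fr)[x [_ <- /= <- //]]].
by apply/(frame_tor fr); exists (iota v); rewrite /= tau_iota.
Qed.

(* Index shift: [form_lcs b k] corresponds to [lcs m k.+1]. *)
Fixpoint form_lcs (b : K -> K -> K) (k : nat) : K -> Prop :=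
  match k with
  | 0 => zspan (fun z => exists x y, z = b x y)
  | k'.+1 => zspan (fun z => exists x y, form_lcs b k' x /\ z = b (pi (iota x)) y)
  end.

Lemma zspan_iota (S : M -> Prop) (S' : K -> Prop) :
  (forall x, S x <-> exists2 v, S' v & x = iota v) ->
  forall x, zspan S x <-> exists2 v, zspan S' v & x = iota v.
Proof.
move=> SS' x; split.
  elim=> [{}x /SS'[v Sv ->]||{}x y _ [v Sv ->] _ [w Sw ->]].
  - by exists v => //; apply: zspan_gen.
  - by exists 0; rewrite ?morphD0 //; apply: zspan_0.
  - by exists (v - w); rewrite ?morphDB //; apply: zspan_sub.
case=> v + -> {x}; elim=> [{}v Sv||{}v w _ IHv _ IHw].
- by apply/zspan_gen/SS'; exists v.
- by rewrite morphD0 //; apply: zspan_0.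
- by rewrite morphDB //; apply: zspan_sub.
Qed.

Lemma lcs_represents m b k x : represents pi iota m b ->
  lcs m k.+1 x <-> exists2 v, form_lcs b k v & x = iota v.
Proof.
move=> mb; have [s sK] := pi_section.
elim: k x => [|k IHk] x; apply: zspan_iota => {}x; split.
- by case=> y [z [_ ->]]; exists (b (pi y) (pi z)); [exists (pi y), (pi z)|].
- by case=> _ [u [v ->]] ->; exists (s u), (s v); rewrite mb !sK.
- case=> y [z [/IHk[v Lv ->] ->]]; exists (b (pi (iota v)) (pi z)) => //.
  by exists v, (pi z).
- case=> _ [u [v [Lu ->]]] ->; exists (iota u), (s v); rewrite mb !sK.
  by split=> //; apply/IHk; exists u.
Qed.

Lemma nilpotent_represents m b : represents pi iota m b ->
  nilpotent_ring m <-> exists k, forall v, form_lcs b k v -> v = 0.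
Proof.
move=> mb; split=> -[k Lk].
  (* The bound [k] concerns [lcs m k], whereas [form_lcs b k] matches [lcs m k.+1]; [lcs_shrink]
     bridges the gap. *)
  exists k => v Lv; apply: (frame_iota_ker fr); apply/Lk/lcs_shrink.
  by apply/(lcs_represents k _ mb); exists v.
exists k.+1 => x /(lcs_represents k _ mb)[v /Lk-> ->]; exact: morphD0.
Qed.

End OneFrame.

(** * Transport of products between two frames of the same type *)

Section TwoFrames.
Variables (M1 M2 : zmodType) (tau1 : M1 -> M1) (tau2 : M2 -> M2).
Variables (pi1 : M1 -> K) (pi2 : M2 -> K) (iota1 : K -> M1) (iota2 : K -> M2).
Hypotheses (fr1 : frame tau1 pi1 iota1) (fr2 : frame tau2 pi2 iota2).

Lemma pi_iota_eq v : pi1 (iota1 v) = pi2 (iota2 v).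
Proof.
by apply/(pi_iota_torsion fr1)/(pi_iota_torsion fr2).
Qed.

Lemma form_lcs_eq b k v : form_lcs pi1 iota1 b k v <-> form_lcs pi2 iota2 b k v.
Proof.
have zspan_eq (S S' : K -> Prop) : (forall u, S u <-> S' u) ->
    forall u, zspan S u -> zspan S' u.
  move=> SS' u; elim=> [w /SS'|| *]; [exact: zspan_gen|exact: zspan_0|].
  exact: zspan_sub.
elim: k v => [//|k IHk] v; split; apply: zspan_eq => u;
  by split=> -[x [y [/IHk Lx ->]]]; exists x, y; rewrite pi_iota_eq.
Qed.

(** [F] reads the form of a product on [M1] and rebuilds a product on [M2] from it. Every property
    concerned depends only on the form, [torsion_pair] and [pi \o iota], all common to both
    sides. *)
Theorem frame_correspondence :
  exists F : (M1 -> M1 -> M1) -> (M2 -> M2 -> M2),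
    [/\ forall m, tau_good tau1 m -> tau_good tau2 (F m),
        forall m m', tau_good tau1 m -> tau_good tau1 m' ->
          (tau_iso tau1 m m' <-> tau_iso tau2 (F m) (F m')),
        forall a, tau_good tau2 a ->
          exists m, tau_good tau1 m /\ tau_iso tau2 (F m) a,
        forall m, tau_good tau1 m -> (is_Lie m <-> is_Lie (F m))
      & forall m, tau_good tau1 m ->
          (nilpotent_ring m <-> nilpotent_ring (F m))].
Proof.
have [s1 s1K] := pi_section fr1; have [s2 s2K] := pi_section fr2.
have [r1 r1K] := iota_retraction fr1; have [r2 r2K] := iota_retraction fr2.
pose form m u v := r1 (m (s1 u) (s1 v)).
pose F m x y := iota2 (form m (pi2 x) (pi2 y)).
have rep1 m : tau_good tau1 m -> represents pi1 iota1 m (form m).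
  exact: (tau_good_represents fr1 s1K r1K).
have rep2 m : represents pi2 iota2 (F m) (form m) by [].
exists F; split.
- move=> m gm; apply: (represents_tau_good fr2 _ (rep2 m)).
  exact: (represents_biadditive fr1 s1K gm (rep1 _ gm)).
- move=> m m' /rep1 rm /rep1 rm'; split.
    move=> /(tau_iso_form fr1 s1K r1K rm rm').
    exact: (form_tau_iso fr2 s2K (rep2 _) (rep2 _)).
  move=> /(tau_iso_form fr2 s2K r2K (rep2 _) (rep2 _)).
  exact: (form_tau_iso fr1 s1K).
- move=> a ga; have ra := tau_good_represents fr2 s2K r2K ga.
  pose b u v := r2 (a (s2 u) (s2 v)).
  pose m x y := iota1 (b (pi1 x) (pi1 y)).
  have rm : represents pi1 iota1 m b by [].
  exists m; split.
    exact: (represents_tau_good fr1 (represents_biadditive fr2 s2K ga ra) rm).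
  (* [F m] and [a] agree pointwise, so the identity serves as the isomorphism. *)
  exists id; split=> // [|x y]; first by exists id.
  by rewrite ra /F /form /m r1K !s1K.
- move=> m gm; apply: (iff_trans (is_Lie_represents fr1 s1K (rep1 _ gm))).
  apply: iff_sym; apply: (iff_trans (is_Lie_represents fr2 s2K (rep2 m))).
  by split=> -[alt jac]; split=> // u v w; rewrite -(jac u v w) !pi_iota_eq.
- move=> m gm; apply: (iff_trans (nilpotent_represents fr1 (rep1 _ gm))).
  apply: iff_sym; apply: (iff_trans (nilpotent_represents fr2 (rep2 m))).
  by split=> -[k Lk]; exists k => v /form_lcs_eq/Lk.
Qed.

End TwoFrames.
End Frames.

(** * Uniserial modules: one cyclic summand *)

Section Uniserial.
Variables (p : nat) (G : zmodType) (l : nat).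
Variables (ta : G -> G) (pr : G -> 'F_p) (io : 'F_p -> G) (g : G).

(** The common shape of [Z/p^l] under [p] and [F_p[T]/(T^l)] under [T]: [pr] is the top quotient,
    [io] the socle, and [uni_top] normalises one against the other through [ta^(l-1)]. *)
Record uniserial : Prop := Uniserial {
  uni_taD : {morph ta : x y / x + y};
  uni_prD : {morph pr : x y / x + y};
  uni_ioD : {morph io : x y / x + y};
  uni_gen : pr g = 1;
  uni_pr_ker : forall x, pr x = 0 -> exists y, x = ta y;
  uni_io_ker : forall c, io c = 0 -> c = 0;
  uni_ta_io : forall c, ta (io c) = 0;
  uni_ta_ker : forall x, ta x = 0 -> exists c, x = io c;
  uni_top : forall x, iter l.-1 ta x = io (pr x) }.

Hypotheses (l_gt0 : (0 < l)%N) (uni : uniserial).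
Let taD := uni_taD uni.
Let iter_taD k := iter_morphD k taD.

Lemma uni_pr_genMn (c : 'F_p) : pr (g *+ c) = c.
Proof. by rewrite (morphDMn (uni_prD uni)) (uni_gen uni) natr_Zp. Qed.

Lemma uni_nil k x : (l <= k)%N -> iter k ta x = 0.
Proof.
move=> /subnK <-; rewrite iterD -(prednK l_gt0) iterS (uni_top uni) (uni_ta_io uni).
exact: (morphD0 (iter_taD _)).
Qed.

Lemma uni_pr_ta x : pr (ta x) = 0.
Proof.
apply: (uni_io_ker uni); rewrite -(uni_top uni) -iterSr prednK //.
exact: uni_nil.
Qed.

(** For [k + 1 < l] the kernel of [ta^(k+1)] is [ta^(l-k-1) G], on which [pr] vanishes. For
    [l = k + 1] it is all of [G] and [uni_top] forces [u = v]. For larger [k] already [ta^k] is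
    zero. *)
Lemma uni_tor k u v :
  [/\ (k.+1 < l)%N -> u = 0, l = k.+1 -> u = v & (l < k.+1)%N -> v = 0] <->
  exists x, [/\ iter k.+1 ta x = 0, pr x = u & iter k ta x = io v].
Proof.
split=> [[u0 uv v0]|[x [x0 xu xv]]].
  case: (ltngtP l k.+1) => lk.
  - exists (g *+ u); split; rewrite ?uni_nil ?uni_pr_genMn ?(ltnW lk) //.
    by rewrite v0 // (morphD0 (uni_ioD uni)).
  (* The witness is [ta^(l-1-k)] applied to a lift of [v]; the exponent is positive here, so [pr]
     kills the witness. *)
  - have lE : l.-1 = (k + (l.-1 - k))%N by rewrite subnKC // -ltnS prednK // ltnW.
    have top : iter k ta (iter (l.-1 - k) ta (g *+ v)) = io v.
      by rewrite -iterD -lE (uni_top uni) uni_pr_genMn.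
    exists (iter (l.-1 - k) ta (g *+ v)); split=> //.
      by rewrite iterS top (uni_ta_io uni).
    case E: (l.-1 - k)%N => [|d]; last by rewrite iterS uni_pr_ta u0.
    by move: lk; rewrite -(prednK l_gt0) lE E addn0 ltnn.
  - exists (g *+ u); split; [by rewrite uni_nil ?lk|exact: uni_pr_genMn|].
    by rewrite -uv // -[k]/(k.+1.-1) -lk (uni_top uni) uni_pr_genMn.
split=> lk.
- rewrite -xu; apply: (uni_io_ker uni); rewrite -(uni_top uni).
  have lE : l.-1 = ((l.-1 - k.+1) + k.+1)%N by rewrite subnK // -ltnS prednK.
  by rewrite lE iterD x0 (morphD0 (iter_taD _)).
- apply: (morphD_inj (uni_ioD uni) (uni_io_ker uni)).
  by rewrite -xv -xu -(uni_top uni) lk.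
- by apply: (uni_io_ker uni); rewrite -xv uni_nil.
Qed.

End Uniserial.

(** * Frames on direct sums of uniserial modules *)

Section DirectSum.
Variables (p t : nat) (lam : 'I_t -> nat) (G : 'I_t -> zmodType).
Variables (ta : forall i, G i -> G i) (pr : forall i, G i -> 'F_p).
Variables (io : forall i, 'F_p -> G i) (g : forall i, G i).

Definition dsum_tau (x : dsum G) : dsum G := finfun (fun i => ta (x i)).
Definition dsum_pi (x : dsum G) : 'rV['F_p]_t := \row_i pr (x i).
Definition dsum_iota (v : 'rV['F_p]_t) : dsum G := finfun (fun i => io i (v 0 i)).
(** Writing [g i] in place of [g j] keeps the value in [G i] without a cast. *)
Definition dsum_gen (j : 'I_t) : dsum G :=
  finfun (fun i => if i == j then g i else 0).

Lemma dsumDE (x y : dsum G) i : (x + y) i = x i + y i.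
Proof. by rewrite ffunE. Qed.

Lemma dsum_tauE k x i : iter k dsum_tau x i = iter k (@ta i) (x i).
Proof. by apply: (iter_comm (f := fun y : dsum G => y i)) => y; rewrite ffunE. Qed.

Hypotheses (p_pr : prime p) (lam_gt0 : forall i, (0 < lam i)%N).
Hypothesis uni : forall i, uniserial (lam i) (@ta i) (@pr i) (io i) (g i).
Hypothesis inj_bij : forall f : dsum G -> dsum G, injective f -> bijective f.
Hypothesis lift : forall y : 'I_t -> dsum G,
  (forall j, iter (lam j) dsum_tau (y j) = 0) ->
  exists f : dsum G -> dsum G, [/\ {morph f : x y / x + y},
    forall x, f (dsum_tau x) = dsum_tau (f x) & forall j, f (dsum_gen j) = y j].

Lemma dsum_frame : frame lam dsum_tau dsum_pi dsum_iota.
Proof.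
have dsumP (x y : dsum G) : (forall i, x i = y i) -> x = y by move/ffunP.
split=> //.
- by move=> x y; apply: dsumP => i; rewrite !ffunE (uni_taD (uni i)).
- by move=> x y; apply/rowP => i; rewrite !mxE ffunE (uni_prD (uni i)).
- by move=> x y; apply: dsumP => i; rewrite !ffunE mxE (uni_ioD (uni i)).
- move=> u; exists (finfun (fun i => g i *+ (u 0 i)%R)).
  by apply/rowP => i; rewrite mxE ffunE (uni_pr_genMn (uni i)).
- by move=> x; apply/rowP => i; rewrite !mxE ffunE (uni_pr_ta (lam_gt0 i) (uni i)).
- move=> x /rowP x0.
  (* The boolean equality lets [xchoose] pick the coordinates of a preimage. *)
  have ex i : exists y, ta y == x i.
    have [|y ->] := uni_pr_ker (uni i) (x := x i); last by exists y.
    by have := x0 i; rewrite !mxE.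
  exists (finfun (fun i => xchoose (ex i))); apply: dsumP => i.
  by rewrite !ffunE (eqP (xchooseP (ex i))).
- move=> v v0; apply/rowP => i; rewrite mxE; apply: (uni_io_ker (uni i)).
  by move/ffunP: v0 => /(_ i); rewrite !ffunE.
- by move=> v; apply: dsumP => i; rewrite !ffunE (uni_ta_io (uni i)).
- move=> x x0.
  have ex i : exists c, io i c == x i.
    have [|c ->] := uni_ta_ker (uni i) (x := x i); last by exists c.
    by move/ffunP: x0 => /(_ i); rewrite !ffunE.
  exists (\row_i xchoose (ex i)); apply: dsumP => i.
  by rewrite ffunE mxE (eqP (xchooseP (ex i))).
- exists (\max_i lam i)%N => x; apply: dsumP => i; rewrite dsum_tauE ffunE.
  by rewrite (uni_nil (lam_gt0 i) (uni i)) // leq_bigmax.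
- move=> k u v; split=> [tor|[x [x0 xu xv]] i].
    have ex i : exists x, [&& iter k.+1 (@ta i) x == 0, pr x == u 0 i
                            & iter k (@ta i) x == io i (v 0 i)].
      have /(uni_tor (lam_gt0 i) (uni i))[x [x0 xu xv]] := tor i.
      by exists x; rewrite x0 xu xv !eqxx.
    exists (finfun (fun i => xchoose (ex i))).
    split; [apply: dsumP => i|apply/rowP => i|apply: dsumP => i];
      have /and3P[/eqP x0 /eqP xu /eqP xv] := xchooseP (ex i).
    + by rewrite dsum_tauE !ffunE.
    + by rewrite mxE ffunE.
    + by rewrite dsum_tauE !ffunE.
  apply/(uni_tor (lam_gt0 i) (uni i)); exists (x i).
  by rewrite -!dsum_tauE x0 xv -xu !ffunE mxE; split.
- exists dsum_gen; split=> // j.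
    apply/rowP => i; rewrite !mxE ffunE eqxx /=.
    by case: (i == j); rewrite ?(uni_gen (uni i)) ?(morphD0 (uni_prD (uni i))).
  apply: dsumP => i; rewrite dsum_tauE !ffunE mxE eqxx /=.
  case: eqVneq => [->|_]; first by rewrite (uni_top (uni j)) (uni_gen (uni j)).
  rewrite (morphD0 (uni_ioD (uni i))).
  exact: (morphD0 (iter_morphD _ (uni_taD (uni i)))).
Qed.

End DirectSum.

(** * The cyclic group of order [p^l] under multiplication by [p] *)

Section CyclicGroup.
Variables (p l : nat).
Hypotheses (p_pr : prime p) (l_gt0 : (0 < l)%N).
Local Notation Zq := ('Z_(p ^ l) : zmodType).

Definition Zq_tau (x : Zq) : Zq := x *+ p.
Definition Zq_pr (x : Zq) : 'F_p := (x : 'Z_(p ^ l))%:R.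
Definition Zq_io (c : 'F_p) : Zq := (p ^ l.-1)%:R *+ c.

(** The type ['Z_q] has [q] elements only for [q > 1]. *)
Let q_gt1 : (1 < p ^ l)%N.
Proof. by rewrite -(exp1n l) ltn_exp2r ?prime_gt1. Qed.

Let qE : (p ^ l = p * p ^ l.-1)%N.
Proof. by rewrite -expnS prednK. Qed.

Lemma Zq_natr_eq0 k : ((k%:R : 'Z_(p ^ l)) == 0) = (p ^ l %| k)%N.
Proof. by rewrite -val_eqE /= val_Zp_nat. Qed.

Lemma Zq_iter_tau k (x : Zq) : iter k Zq_tau x = x *+ (p ^ k).
Proof. by elim: k => //= k ->; rewrite /Zq_tau -mulrnA expnSr. Qed.

Lemma Zq_valD (M : zmodType) (z : M) (x y : 'Z_(p ^ l)) :
  z *+ (p ^ l) = 0 -> z *+ (x + y)%R = z *+ x + z *+ y.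
Proof. by move=> zq; rewrite -mulrnDr [LHS]mulrn_mod // Zp_cast. Qed.

(** On natural representatives each kernel condition becomes a divisibility, settled by cancelling a
    factor in [p^l = p * p^(l-1)]. *)
Lemma Zq_uniserial : uniserial l Zq_tau Zq_pr Zq_io (1 : 'Z_(p ^ l)).
Proof.
have pP0 : (0 < p ^ l.-1)%N by rewrite expn_gt0 prime_gt0.
have ioD : {morph Zq_io : x y / x + y}.
  by move=> c d; apply: FpMnD => //; rewrite -mulrnA mulnC -qE pchar_Zp.
split=> //.
- by move=> x y; rewrite /Zq_tau mulrnDl.
- move=> x y; rewrite /Zq_pr Zq_valD //.
  by rewrite qE natrM pchar_Fp_0 // mul0r.
- move=> x /eqP; rewrite /Zq_pr -val_eqE /= val_Fp_nat // => /dvdnP[k xk].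
  by exists (k%:R : 'Z_(p ^ l)); rewrite /Zq_tau -mulrnA -xk natr_Zp.
- move=> c /eqP; rewrite /Zq_io -mulrnA Zq_natr_eq0 qE mulnC dvdn_pmul2l //.
  by move=> pc; rewrite -[c]natr_Zp; apply/eqP; rewrite -val_eqE /= val_Fp_nat.
- move=> c; rewrite /Zq_tau /Zq_io mulrnAC -[_ *+ p]mulrnA mulnC -qE.
  by rewrite pchar_Zp // mul0rn.
- move=> x /eqP; rewrite /Zq_tau -[x]natr_Zp -mulrnA Zq_natr_eq0.
  rewrite [X in (X %| _)%N]qE mulnC dvdn_pmul2r ?prime_gt0 // => /dvdnP[k xk].
  exists (k%:R : 'F_p); rewrite /Zq_io val_Fp_nat // mulrn_mod.
    by rewrite -mulrnA mulnC -xk.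
  by rewrite -mulrnA mulnC -qE pchar_Zp.
- move=> x; rewrite Zq_iter_tau /Zq_io /Zq_pr val_Fp_nat // mulrn_mod.
    by rewrite -[x in LHS]natr_Zp -!mulrnA mulnC.
  by rewrite -mulrnA mulnC -qE pchar_Zp.
Qed.

End CyclicGroup.

(** * Truncated polynomials under multiplication by [T] *)

Section TruncatedPolynomials.
Variables (p l : nat).
Hypotheses (p_pr : prime p) (l_gt0 : (0 < l)%N).
Local Notation Q := ({poly %/ ('X^l : {poly 'F_p})} : zmodType).

Definition tpoly_tau (x : Q) : Q := in_qpoly ('X^l : {poly 'F_p}) ('X * (x : {poly 'F_p})).
Definition tpoly_pr (x : Q) : 'F_p := (x : {poly 'F_p})`_0.
Definition tpoly_io (c : 'F_p) : Q := in_qpoly ('X^l : {poly 'F_p}) (c *: 'X^(l.-1)).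
Definition tpoly_gen : Q := in_qpoly ('X^l : {poly 'F_p}) 1.

(** The quotient type divides by [mk_monic h], which falls back to ['X] when [h] is constant;
    positivity of [l] excludes this. *)
Lemma mk_monicXn : mk_monic ('X^l : {poly 'F_p}) = 'X^l.
Proof. by rewrite /mk_monic size_polyXn monicXn ltnS l_gt0. Qed.

Lemma coef_in_qpolyXn (f : {poly 'F_p}) d :
  (in_qpoly ('X^l : {poly 'F_p}) f : {poly 'F_p})`_d = if (d < l)%N then f`_d else 0.
Proof. by rewrite /= mk_monicXn -Pdiv.RingMonic.take_poly_rmodp coef_take_poly. Qed.

Lemma coef_qpolyXn_big (x : Q) d : (l <= d)%N -> (x : {poly 'F_p})`_d = 0.
Proof.
by move=> ld; apply: big_coef_npoly; rewrite mk_monicXn size_polyXn.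
Qed.

Lemma qpolyXnP (x y : Q) :
  (forall d, (d < l)%N -> (x : {poly 'F_p})`_d = (y : {poly 'F_p})`_d) -> x = y.
Proof.
move=> xy; apply/val_inj/polyP => d; case: (ltnP d l) => [/xy //|ld].
by rewrite !coef_qpolyXn_big.
Qed.

Lemma coef_tpoly_iter_tau k (x : Q) d : (d < l)%N ->
  (iter k tpoly_tau x : {poly 'F_p})`_d =
  if (k <= d)%N then (x : {poly 'F_p})`_(d - k) else 0.
Proof.
elim: k d => [|k IHk] d dl; first by rewrite subn0.
rewrite iterS coef_in_qpolyXn dl coefXM; case: d dl => [|d] dl //=.
by rewrite IHk // ltnW.
Qed.

Lemma tpoly_uniserial : uniserial l tpoly_tau tpoly_pr tpoly_io tpoly_gen.
Proof.
split.
- by move=> x y; rewrite /tpoly_tau /= mulrDr in_qpolyD.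
- by move=> x y; rewrite /tpoly_pr /= coefD.
- by move=> c d; rewrite /tpoly_io scalerDl in_qpolyD.
- by rewrite /tpoly_pr coef_in_qpolyXn l_gt0 coef1.
- move=> x x0; exists (in_qpoly ('X^l : {poly 'F_p}) (drop_poly 1 (x : {poly 'F_p}))).
  apply: qpolyXnP => d dl; rewrite coef_in_qpolyXn dl coefXM; case: d dl => [//|d] dl.
  by rewrite coef_in_qpolyXn coef_drop_poly addn1 ltnW.
- move=> c /(congr1 (fun x : Q => (x : {poly 'F_p})`_l.-1)).
  by rewrite coef_in_qpolyXn coefZ coefXn eqxx mulr1 prednK // leqnn coef0.
- move=> c; apply: qpolyXnP => -[|d] dl; rewrite coef_in_qpolyXn dl coefXM coef0 //.
  rewrite coef_in_qpolyXn coefZ coefXn ltnW //= ltn_eqF ?mulr0 //.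
  by rewrite -ltnS prednK.
- move=> x x0; exists ((x : {poly 'F_p})`_l.-1); apply: qpolyXnP => d dl.
  rewrite coef_in_qpolyXn dl coefZ coefXn.
  case: eqVneq => [->|dl']; rewrite ?mulr1 // mulr0.
  have dl1 : (d.+1 < l)%N.
    by rewrite ltn_neqAle dl andbT; apply: contraNneq dl' => <-.
  have := congr1 (fun x : Q => (x : {poly 'F_p})`_d.+1) x0.
  by rewrite coef_in_qpolyXn dl1 coefXM coef0.
- move=> x; apply: qpolyXnP => d dl; rewrite coef_tpoly_iter_tau //.
  rewrite coef_in_qpolyXn dl coefZ coefXn.
  case: (eqVneq d l.-1) => [->|dl']; first by rewrite leqnn subnn mulr1.
  by rewrite mulr0 leqNgt ltn_neqAle dl' -ltnS prednK ?dl.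
Qed.

End TruncatedPolynomials.

Lemma zspan_mulrn (M : zmodType) (S : M -> Prop) x k : zspan S x -> zspan S (x *+ k).
Proof.
move=> Sx; elim: k => [|k IHk]; first exact: zspan_0.
(* [zspan] is closed under differences, so adding [x] is subtracting [0 - x]. *)
rewrite mulrSr -[x in _ + x]opprK -[- x]sub0r.
by apply: zspan_sub => //; apply: zspan_sub => //; apply: zspan_0.
Qed.

(** * The frames of [U] and [V], and translation of their structures *)

Section Instances.
Variables (p : nat) (lam : seq nat).
Hypotheses (p_pr : prime p) (lam_pos : all (fun k => 0 < k)%N lam).
Local Notation t := (size lam).
Local Notation part := (fun i : 'I_t => nth 0 lam i).
Local Notation U := (Ugrp p lam).
Local Notation V := (Vgrp p lam).

Let part_gt0 (i : 'I_t) : (0 < nth 0 lam i)%N.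
Proof. exact: (all_nthP 0 lam_pos). Qed.

Definition U_tau : U -> U := dsum_tau (fun i : 'I_t => @Zq_tau p (nth 0 lam i)).
Definition U_pi : U -> 'rV['F_p]_t := dsum_pi (fun i : 'I_t => @Zq_pr p (nth 0 lam i)).
Definition U_iota : 'rV['F_p]_t -> U :=
  dsum_iota (fun i : 'I_t => @Zq_io p (nth 0 lam i)).

Lemma UMnE (x : U) k i : (x *+ k) i = x i *+ k.
Proof. by elim: k => [|k IHk]; rewrite ?mulr0n ?mulrS ffunE // IHk. Qed.

Lemma U_tauE (x : U) : U_tau x = x *+ p.
Proof. by apply/ffunP => i; rewrite ffunE UMnE. Qed.

Lemma U_iter_tau k (x : U) : iter k U_tau x = x *+ (p ^ k).
Proof. by elim: k => //= k ->; rewrite U_tauE -mulrnA expnSr. Qed.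

Lemma U_frame : frame part U_tau U_pi U_iota.
Proof.
apply: (dsum_frame (g := fun i : 'I_t => (1 : 'Z_(p ^ nth 0 lam i)))) => //.
- by move=> i; apply: Zq_uniserial.
- move=> f; exact: (@injF_bij {dffun forall i : 'I_t, 'Z_(p ^ nth 0 lam i)} f).
move=> y y0.
have yq j : y j *+ (p ^ nth 0 lam j) = 0 by rewrite -U_iter_tau; apply: y0.
(* The order of [y i] divides [p^(lam_i)], so multiples by representatives of [x i] are additive in
   [x]. *)
pose f (x : U) := \sum_i y i *+ (x i : 'Z_(p ^ nth 0 lam i)).
have fD : {morph f : x y / x + y}.
  by move=> x z; rewrite /f -big_split; apply: eq_bigr => i _; rewrite dsumDE Zq_valD.
exists f; split=> //.
  move=> x; change (f (U_tau x) = U_tau (f x)).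
  by rewrite !U_tauE (morphDMn fD).
move=> j; rewrite /f (bigD1 j) //= ffunE eqxx big1 ?addr0 // => i ij.
by rewrite ffunE (negPf ij).
Qed.

Lemma goodU_tau_good m : @goodU p lam m <-> tau_good U_tau m.
Proof.
split=> [[[mDl mDr] mp]|[mD mp _ _]]; last first.
  by split=> // x y; rewrite -U_tauE mp.
split=> // x y; rewrite U_tauE //.
  by rewrite (morphDMn (fun u v => mDl u v y)).
by rewrite (morphDMn (mDr x)).
Qed.

Lemma ring_iso_tau_iso m1 m2 : ring_iso m1 m2 <-> tau_iso U_tau m1 m2.
Proof.
split=> [[f [fb fD fm]]|[f [fb fD _ fm]]]; exists f; split=> // x.
by rewrite !U_tauE (morphDMn fD).
Qed.

Definition V_tau : V -> V := dsum_tau (fun i : 'I_t => @tpoly_tau p (nth 0 lam i)).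
Definition V_pi : V -> 'rV['F_p]_t := dsum_pi (fun i : 'I_t => @tpoly_pr p (nth 0 lam i)).
Definition V_iota : 'rV['F_p]_t -> V :=
  dsum_iota (fun i : 'I_t => @tpoly_io p (nth 0 lam i)).

Lemma VMnE (x : V) k i d : ((x *+ k) i : {poly 'F_p})`_d = (x i : {poly 'F_p})`_d *+ k.
Proof.
elim: k => [|k IHk]; first by rewrite !mulr0n ffunE coef0.
by rewrite !mulrS ffunE coefD IHk.
Qed.

Lemma VP (x y : V) :
  (forall (i : 'I_t) d, (d < nth 0 lam i)%N ->
    (x i : {poly 'F_p})`_d = (y i : {poly 'F_p})`_d) -> x = y.
Proof. by move=> xy; apply/ffunP => i; apply: qpolyXnP => // d dl; apply: xy. Qed.

Lemma V_mulrn_p (x : V) : x *+ p = 0.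
Proof.
apply: VP => i d _; rewrite VMnE ffunE coef0 -mulr_natr.
by rewrite pchar_Fp_0 // mulr0.
Qed.

Lemma V_tauD : {morph V_tau : x y / x + y}.
Proof.
by move=> x y; apply/ffunP => i; rewrite !ffunE (uni_taD (tpoly_uniserial p (part_gt0 i))).
Qed.

Lemma V_frame : frame part V_tau V_pi V_iota.
Proof.
apply: (dsum_frame (g := fun i : 'I_t => tpoly_gen p (nth 0 lam i))) => //.
- by move=> i; apply: tpoly_uniserial.
- move=> f; exact: (@injF_bij
    {dffun forall i : 'I_t, {poly %/ ('X^(nth 0 lam i) : {poly 'F_p})}} f).
move=> y y0.
(* This sends [T^k e_i] to [T^k y_i], extended by the coefficients of [x]. *)
pose f (x : V) := \sum_(i < t) \sum_(k < nth 0 lam i)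
  iter k V_tau (y i) *+ ((x i : {poly 'F_p})`_k)%R.
exists f; split.
- move=> x z; rewrite /f -big_split; apply: eq_bigr => i _.
  rewrite -big_split; apply: eq_bigr => k _.
  by rewrite ffunE coefD FpMnD ?V_mulrn_p.
- move=> x; change (f (V_tau x) = V_tau (f x)).
  rewrite /f (morphD_sum V_tauD); apply: eq_bigr => i _.
  rewrite (morphD_sum V_tauD) ffunE.
  under eq_bigr => k _ do rewrite coef_in_qpolyXn // ltn_ord coefXM.
  under [RHS]eq_bigr => k _ do rewrite (morphDMn V_tauD) -iterS.
  (* Multiplication by [T] shifts coefficients up by one; the top term lost to truncation is matched
     by [T^l y_i = 0]. *)
  have shift (c : nat -> 'F_p) l : (0 < l)%N -> iter l V_tau (y i) = 0 ->
      \sum_(k < l) iter k V_tau (y i) *+ (if k == 0 :> nat then 0 else c k.-1)%R =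
      \sum_(k < l) iter k.+1 V_tau (y i) *+ c k.
    case: l => [//|l] _ yl.
    rewrite big_ord_recl big_ord_recr /=.
    have -> : V_tau (iter l V_tau (y i)) = 0 by exact: yl.
    by rewrite mul0rn addr0 add0r.
  exact: (shift (fun d => (x i : {poly 'F_p})`_d) _ (part_gt0 i) (y0 i)).
- move=> j; rewrite /f (bigD1 j) //= [X in _ + X]big1 => [|i ij]; last first.
    by rewrite big1 // => k _; rewrite ffunE (negPf ij) coef0.
  rewrite addr0 ffunE eqxx.
  under eq_bigr => k _ do rewrite coef_in_qpolyXn // ltn_ord coef1.
  case: (nth 0 lam j) (part_gt0 j) => [//|l] _.
  by rewrite big_ord_recl big1 ?addr0.
Qed.

Variable n : nat.
Hypothesis lam_le_n : forall i : 'I_t, (nth 0 lam i <= n)%N.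

(** Reducing ['X] modulo ['X^n] leaves the coefficients below degree [n] intact, and every part of
    the partition is at most [n]. *)
Lemma actV_Tgen (x : V) : actV (Tgen p n) x = V_tau x.
Proof.
apply: VP => i d di; rewrite !ffunE !coef_in_qpolyXn // di !coefM.
apply: eq_bigr => k _; rewrite coef_in_qpolyXn.
  by rewrite (leq_trans (leq_trans (ltn_ord k) di) (lam_le_n i)).
exact: leq_trans (part_gt0 i) (lam_le_n i).
Qed.

Lemma V_coefD (x y : V) i d :
  ((x + y) i : {poly 'F_p})`_d = (x i : {poly 'F_p})`_d + (y i : {poly 'F_p})`_d.
Proof. by rewrite ffunE coefD. Qed.

(** Scalars act as polynomials in [V_tau], so additive maps commuting with [V_tau] are linear over
    the whole ring. *)
Lemma actVE (c : Cring p n) (x : V) :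
  actV c x = \sum_(k < size (c : {poly 'F_p})) iter k V_tau x *+ ((c : {poly 'F_p})`_k)%R.
Proof.
apply: VP => i d di; rewrite ffunE coef_in_qpolyXn // di.
rewrite (morphD_sum (f := fun y : V => (y i : {poly 'F_p})`_d)); last first.
  by move=> y z; apply: V_coefD.
rewrite -{1}[c : {poly 'F_p}]coefK poly_def mulr_suml coef_sum.
apply: eq_bigr => k _; rewrite VMnE dsum_tauE coef_tpoly_iter_tau //.
rewrite -scalerAl coefZ coefXnM ltnNge -mulr_natl natr_Zp.
by case: (k <= d)%N.
Qed.

Lemma actV_tau0 (c : Cring p n) (x : V) : V_tau x = 0 ->
  actV c x = x *+ ((c : {poly 'F_p})`_0)%R.
Proof.
move=> x0; rewrite actVE; case: (size _) (@nth_default _ 0 (c : {poly 'F_p})) => [|s] c0.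
  by rewrite big_ord0 c0.
rewrite big_ord_recl big1 ?addr0 // => k _.
rewrite iterSr x0 (morphD0 (iter_morphD _ V_tauD)); exact: mul0rn.
Qed.

Lemma actV_comm (f : V -> V) : {morph f : x y / x + y} ->
  (forall x, f (V_tau x) = V_tau (f x)) ->
  forall (c : Cring p n) x, f (actV c x) = actV c (f x).
Proof.
move=> fD ft c x; rewrite !actVE (morphD_sum fD); apply: eq_bigr => k _.
by rewrite (morphDMn fD) (iter_comm _ ft).
Qed.

(** Conversely, when products vanish on [V_tau]-images and are killed by [V_tau], each partial map
    commutes with [V_tau] because both sides are 0; [actV_comm] then gives linearity. *)
Lemma goodV_tau_good a : @goodV p n lam a <-> tau_good V_tau a.
Proof.
split=> [[[aD [aCl aCr]] aT]|[[aDl aDr] aT atl atr]].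
  by split=> // x y; rewrite -actV_Tgen ?aCl ?aCr ?aT.
split; last by move=> x y; rewrite actV_Tgen.
split=> //; split=> c x y.
  apply: (actV_comm (f := a^~ y)) => [u v|u]; first exact: aDl.
  by rewrite atl aT.
apply: (actV_comm (f := a x)) => [u v|u]; first exact: aDr.
by rewrite atr aT.
Qed.

Lemma Calg_iso_tau_iso a1 a2 : Calg_iso (@actV p n lam) a1 a2 <-> tau_iso V_tau a1 a2.
Proof.
split=> [[f [fb fD fC fm]]|[f [fb fD ft fm]]]; exists f; split=> //.
  by move=> x; rewrite -!actV_Tgen fC.
exact: actV_comm.
Qed.

(** Products are killed by [T], so on their span a scalar acts by its constant coefficient, a
    natural multiple; additive and linear spans coincide. *)
Lemma lcsC_lcs a k x : tau_good V_tau a -> lcsC (@actV p n lam) a k x <-> lcs a k x.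
Proof.
move=> [_ aT _ _]; elim: k x => [//|k IHk] x; split=> /=.
  (* The induction must carry [V_tau x = 0], which handles the scalar action case. *)
  move=> Lx; suff [] : lcs a k.+1 x /\ V_tau x = 0 by [].
  elim: Lx => [{}x [y [z [/IHk Ly ->]]]||{}x y _ [Lx x0] _ [Ly y0]|c {}x _ [Lx x0]].
  - by split=> //; apply: zspan_gen; exists y, z.
  - by split; [apply: zspan_0|apply: (morphD0 V_tauD)].
  - by split; [apply: zspan_sub|rewrite (morphDB V_tauD) x0 y0 subrr].
  - rewrite actV_tau0 // (morphDMn V_tauD) x0 mul0rn; split=> //=.
    exact: zspan_mulrn.
elim=> [{}x [y [z [/IHk Ly ->]]]||{}x y _ IHx _ IHy].
- by apply: cspan_gen; exists y, z.
- exact: cspan_0.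
- exact: cspan_sub.
Qed.

End Instances.

(** * The correspondence between products on [U] and on [V] *)

Lemma leq_nth_sumn (s : seq nat) i : (nth 0 s i <= sumn s)%N.
Proof.
elim: s i => [|k s IHs] [|i] //=; first exact: leq_addr.
exact: leq_trans (IHs i) (leq_addl _ _).
Qed.

Theorem theorem2p1 (p n : nat) (lam : seq nat) :
  prime p -> is_partition n lam ->
  exists F : (Ugrp p lam -> Ugrp p lam -> Ugrp p lam) ->
             (Vgrp p lam -> Vgrp p lam -> Vgrp p lam),
    (* (1) F induces a bijection between isomorphism classes *)
    [/\ (forall m, @goodU p lam m -> @goodV p n lam (F m)),
        (forall m1 m2, @goodU p lam m1 -> @goodU p lam m2 ->
           (ring_iso m1 m2 <-> Calg_iso (@actV p n lam) (F m1) (F m2))),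
        (forall a, @goodV p n lam a ->
           exists m, @goodU p lam m /\ Calg_iso (@actV p n lam) (F m) a),
    (* (2) Lie rings correspond exactly to Lie algebras ... *)
        (forall m, @goodU p lam m -> (is_Lie m <-> is_Lie (F m)))
    (* ... and nilpotency is preserved for corresponding Lie objects *)
      & (forall m, @goodU p lam m -> is_Lie m ->
           (nilpotent_ring m <-> nilpotent_Calg (@actV p n lam) (F m)))].
Proof.
move=> p_pr [_ lam_pos lam_n].
have lam_le_n (i : 'I_(size lam)) : (nth 0 lam i <= n)%N by rewrite -lam_n leq_nth_sumn.
have gU := goodU_tau_good (p := p) (lam := lam).
have gV := goodV_tau_good lam_pos lam_le_n.
have isoU := ring_iso_tau_iso (p := p) (lam := lam).
have isoV := Calg_iso_tau_iso lam_pos lam_le_n.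
have part_gt0 (i : 'I_(size lam)) : (0 < nth 0 lam i)%N by apply: (all_nthP 0 lam_pos).
have [F [F_good F_iso F_surj F_Lie F_nil]] :=
  frame_correspondence p_pr part_gt0 (U_frame p_pr lam_pos) (V_frame p_pr lam_pos).
exists F; split.
- by move=> m /gU/F_good/gV.
- move=> m1 m2 /gU g1 /gU g2; apply: (iff_trans (isoU m1 m2)).
  by apply: (iff_trans (F_iso _ _ g1 g2)); apply: iff_sym.
- by move=> a /gV/F_surj[m [/gU gm /isoV iso_a]]; exists m.
- by move=> m /gU/F_Lie.
- move=> m /gU gm _; apply: (iff_trans (F_nil m gm)).
  have lcsE k x := lcsC_lcs lam_pos n k x (F_good m gm).
  by split=> -[k Lk]; exists k => x /lcsE/Lk.
Qed.
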